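(* For integers $s,t\ge 1$ let $F(s,t)\in\mathbb{N}\cup\{\infty\}$ be the smallest integer such that every digraph $D$ with $\delta^+(D)\ge F(s,t)$ admits a partition $V(D)=A\sqcup B$ into non-empty sets $A,B$ with $\delta^+(D[A])\ge s$ and $\delta^+(D[B])\ge t$, where $F(s,t)=\infty$ if no such integer exists. Then the following hold. (1) If $F(2,2)<\infty$, then $F(s,t)=\Theta(s+t)$ for $s,t\ge 1$ (that is, there are constants $c,C>0$ such that $c(s+t)\le F(s,t)\le C(s+t)$ for all integers $s,t\ge 1$). More precisely, for all integers $s,t\ge 1$, $$F(s,t)<\frac{e^2}{3}\cdot F(2,2)^6\cdot \max\{s,t\}.$$ (2) If $F(2,1)<\infty$, then $F(s,1)=\Theta(s)$ for $s\ge 1$ (that is, there are constants $c,C>0$ such that $cs\le F(s,1)\le Cs$ for all integers $s\ge 1$). More precisely, for all integers $s\ge 1$, $$F(s,1)<\frac{e^2}{3}\cdot F(2,1)^6\cdot s.$$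
   Context: Digraphs are finite, have non-empty vertex set, and have no loops and no parallel arcs (pairs of arcs in opposite directions between two vertices are allowed). For a digraph $D$, $V(D)$ is its vertex set, $\delta^+(D)$ is its minimum out-degree (the minimum over all vertices $v$ of the number of out-neighbors of $v$), and for $X\subseteq V(D)$, $D[X]$ denotes the subdigraph induced by $X$. Here $e$ is the base of the natural logarithm. *)

(* Defs.v *)
From HB Require Import structures.
From mathcomp Require Import all_boot all_order all_algebra.
From mathcomp Require Import boolp reals constructive_ereal.

Set Implicit Arguments.
Unset Strict Implicit.
Unset Printing Implicit Defensive.

Import Order.TTheory GRing.Theory Num.Theory.

Record digraph := Digraph {
  vertex :> finType;
  arc : rel vertex;
  arc_irr : irreflexive arc;
  vertex_gt0 : 0 < #|vertex| }.

Definition outdeg (D : digraph) (v : D) : nat := #|[set w : D | arc v w]|.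

(* Every out-degree is less than #|D| and D has a vertex, so the default value
   #|D| of the iterated minimum is never attained. *)
Definition min_outdeg (D : digraph) : nat :=
  \big[minn/#|D|]_(v : D) outdeg v.

Section Induced.
Variables (D : digraph) (X : {set D}) (X0 : X != set0).

Definition induced_arc : rel {x : D | x \in X} :=
  fun x y => arc (val x) (val y).

Lemma induced_arc_irr : irreflexive induced_arc.
Proof. by move=> x; exact: arc_irr. Qed.

Lemma induced_vertex_gt0 : 0 < #|{: {x : D | x \in X}}|.
Proof. by rewrite card_sig card_gt0. Qed.

Definition induced : digraph := Digraph induced_arc_irr induced_vertex_gt0.

End Induced.

Definition has_split (D : digraph) (s t : nat) : Prop :=
  exists (A B : {set D}) (A0 : A != set0) (B0 : B != set0),
    [/\ A :|: B = [set: D], [disjoint A & B],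
        s <= min_outdeg (induced A0) & t <= min_outdeg (induced B0)].

Definition forces_split (s t k : nat) : Prop :=
  forall D : digraph, k <= min_outdeg D -> has_split D s t.

Lemma forces_split_asbool (s t : nat) :
  (exists k, forces_split s t k) -> exists k, `[< forces_split s t k >].
Proof. by move=> [k sk]; exists k; exact/asboolP. Qed.

(* [None] stands for infinity. *)
Definition split_threshold (s t : nat) : option nat :=
  if pselect (exists k, forces_split s t k) is left ex_k
  then Some (ex_minn (forces_split_asbool ex_k)) else None.

Definition F (R : realType) (s t : nat) : \bar R :=
  if split_threshold s t is Some k then (k%:R%:E)%E else (+oo)%E.

(* Main.v *)
Require Import Defs.
From HB Require Import structures.
From mathcomp Require Import all_boot all_order all_algebra.
From mathcomp Require boolp.
From mathcomp Require Import reals constructive_ereal sequences exp zify ring lra.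

Set Implicit Arguments.
Unset Strict Implicit.
Unset Printing Implicit Defensive.

Import Order.TTheory GRing.Theory Num.Theory.

(** Suppose that every digraph of minimum out-degree at least [K] has a split
    with parts of minimum out-degree at least 2.  To make this work for a
    larger target [m], replace each vertex of a digraph [D] by a gadget.

    A circuit is a directed acyclic network of gates, each with exactly [K]
    distinct successors, ending in a set [I] of inputs.  If every selected gate
    has at least two selected successors, then a selected root forces certain
    sets of inputs to be selected.  Suppose that it forces at least [m] of them.
    Put a copy of the circuit at each vertex [v] of [D], identify its root with
    [v], and identify its inputs with out-neighbours of [v].  The new digraph
    is [K]-out-regular, so it has a split into 2-out parts; by the property of
    the circuit, each part meets [D] in a set of minimum out-degree at least
    [m] ([forces_split_scale]).  If the second part is only asked to be 1-out,
    then acyclicity alone shows that it meets [D] in a set of minimum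
    out-degree at least 1.

    What remains is a circuit with few inputs: linearly many in [m]
    ([threshold_circuit]).  It is built by raising the threshold from [s] to
    [s + 1] on a fixed set of [n = 4 K^3 m] inputs, each time replacing every
    input of the circuit found so far by a block, a two-level tree of
    2-out-of-[K] gates over the same [n] inputs.  A block is switched on only
    by four hits, so for random blocks and a fixed set of [s] inputs it is
    switched on with probability of order [K^6 (s / n)^4].  There are about
    [(e n / s)^(2 s)] ways to choose [s] inputs and [s] blocks, while all [s]
    blocks are switched on with probability of order [(K^6 (s / n)^4)^s].  The
    product is [(O(K^6) (s / n)^2)^s], below 1 as soon as [n / s] exceeds a
    constant times [K^3].  So some choice of blocks lets no [s] inputs switch
    on [s] blocks ([dispersing_tables]), and then [s] inputs never switch on
    the root.  Two levels are essential: a single 2-out-of-[K] gate gives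
    [K^2 (s / n)^2], which the number of choices outweighs.

    Hence [F(m, m) <= 4 K^3 m], and [4 K^3 < (e^2 / 3) K^6] as [K >= 2].  The
    linear lower bound comes from complete digraphs. *)

(** * Counting functions and subsets *)

(** The union bound. *)
Lemma leq_card_exists (I T : finType) (P : pred I) (E : I -> {set T}) :
  #|[set x | [exists i, P i && (x \in E i)]]| <= \sum_(i | P i) #|E i|.
Proof.
have -> : [set x | [exists i, P i && (x \in E i)]] = \bigcup_(i | P i) E i.
  apply/setP=> x; rewrite inE; apply/existsP/bigcupP.
    by case=> i /andP[Pi xEi]; exists i.
  by case=> i Pi xEi; exists i; rewrite Pi.
elim/big_rec2: _ => [|i m A Pi le_A_m]; first by rewrite cards0.
by rewrite (leq_trans (leq_card_setU _ _)) // leq_add2l.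
Qed.

(** The constraints [f j \in B j] on a uniformly random [f] are independent; the
    powers of [#|T|] clear the denominators of this statement. *)
Lemma card_ffun_constrained (I T : finType) (J : {set I}) (B : I -> {set T}) :
  #|[set f : {ffun I -> T} | [forall j in J, f j \in B j]]| * #|T| ^ #|J|
  = (\prod_(j in J) #|B j|) * #|T| ^ #|I|.
Proof.
pose G j : pred T := [pred y | (j \in J) ==> (y \in B j)].
have -> : #|[set f : {ffun I -> T} | [forall j in J, f j \in B j]]| =
          \prod_j #|G j|.
  transitivity #|(family G : simpl_pred {ffun I -> T})|.
    apply: eq_card => f; rewrite inE; apply/forall_inP/familyP => fB j.
      by rewrite inE; apply/implyP=> /fB.
    by move=> Jj; have /implyP := fB j; apply.
  by rewrite card_family foldrE big_map enumT.
rewrite (bigID (mem J)) /= -mulnA; congr (_ * _).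
  by apply: eq_bigr => j Jj; apply: eq_card => y; rewrite inE Jj.
rewrite (eq_bigr (fun _ => #|T|)) => [|j /negPf nJj]; last first.
  by apply: eq_card => y; rewrite !inE nJj.
by rewrite prod_nat_const -expnD addnC cardC.
Qed.

(** Union bound over the pairs of coordinates: a random [f] hits [B] at least
    twice with probability at most the square of the expected number of hits.
    It serves for both levels of a block. *)
Lemma card_ffun_two_hits (I T : finType) (B : I -> {set T}) :
  #|[set f : {ffun I -> T} | 1 < #|[set i | f i \in B i]|]| * #|T| ^ 2
  <= (\sum_i #|B i|) ^ 2 * #|T| ^ #|I|.
Proof.
pose E (p : I * I) :=
  [set f : {ffun I -> T} | [forall j in [set p.1; p.2], f j \in B j]].
apply: (@leq_trans ((\sum_(p | p.1 != p.2) #|E p|) * #|T| ^ 2)).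
  rewrite leq_mul2r; apply/orP; right.
  apply: leq_trans (leq_card_exists _ _); apply/subset_leq_card/subsetP=> f.
  rewrite !inE => /card_gt1P[i [j [+ + ij]]]; rewrite !inE => fi fj.
  apply/existsP; exists (i, j); rewrite ij inE /=.
  by apply/forall_inP=> k; rewrite !inE => /orP[]/eqP->.
have -> : (\sum_i #|B i|) ^ 2 = \sum_(p : I * I) #|B p.1| * #|B p.2|.
  rewrite -mulnn big_distrl /=; under eq_bigr do rewrite big_distrr.
  by rewrite pair_big.
rewrite !big_distrl /= [leqRHS](bigID (fun p : I * I => p.1 != p.2)) /=.
apply: leq_trans (leq_addr _ _); rewrite eq_leq //; apply: eq_bigr.
move=> [i j] /= ij; have := card_ffun_constrained [set i; j] B.
rewrite cards2 ij => ->; congr (_ * _).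
by rewrite big_setU1 ?inE // big_set1.
Qed.

(** From [s ^ s <= (2 s) ^_ s = 'C(2 s, s) * s!], with [4 ^ s] in place of
    [e ^ s]. *)
Lemma expnn_leq_fact s : s ^ s <= 4 ^ s * s`!.
Proof.
have le_ffact k m : s <= m -> s ^ k <= (m + k) ^_ k.
  elim: k => [|k IH] sm //; rewrite addnS ffactSS expnS.
  by rewrite leq_mul ?IH // (leq_trans sm) // (leq_trans (leq_addr k _)).
apply: leq_trans (le_ffact s s (leqnn s)) _.
rewrite -bin_ffact leq_mul2r; apply/orP; right.
have -> : 4 ^ s = (1 + 1) ^ (s + s).
  by rewrite -[4]/((1 + 1) ^ 2) -expnM mul2n -addnn.
rewrite expnDn.
have lts : s < (s + s).+1 by rewrite ltnS leq_addr.
by rewrite (bigD1 (Ordinal lts)) //= !exp1n !muln1 leq_addr.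
Qed.

Lemma bin_expn_leq n s : 'C(n, s) * s ^ s <= (4 * n) ^ s.
Proof.
have le_ffact k m : m ^_ k <= m ^ k.
  elim: k m => [|k IH] [|m] //.
  rewrite ffactSS expnS leq_mul // (leq_trans (IH _)) //.
  by case: (k) => [|k'] //; rewrite leq_exp2r.
rewrite (leq_trans (leq_mul (leqnn _) (expnn_leq_fact s))) //.
by rewrite mulnCA bin_ffact expnMn leq_mul.
Qed.

Lemma superset_of_card (T : finType) (A : {set T}) n :
  #|A| <= n <= #|T| -> exists2 B : {set T}, A \subset B & #|B| = n.
Proof.
case/andP=> An nT.
have /card_geqP[u [uniq_u size_u sub_u]] : n - #|A| <= #|~: A|.
  by rewrite leq_subLR cardsC.
exists (A :|: [set x in u]); first exact: subsetUl.
rewrite cardsU (_ : A :&: _ = set0) ?cards0 ?subn0.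
  by rewrite cardsE (card_uniqP uniq_u) size_u subnKC.
by apply/setP=> x; rewrite !inE; apply/negP=> /andP[Ax /sub_u]; rewrite inE Ax.
Qed.

Lemma subset_of_card (T : finType) (A : {set T}) n :
  n <= #|A| -> exists2 B : {set T}, B \subset A & #|B| = n.
Proof.
case/card_geqP=> u [uniq_u size_u sub_u].
exists [set x in u]; last by rewrite cardsE (card_uniqP uniq_u).
by apply/subsetP=> x; rewrite inE => /sub_u.
Qed.

(** * Blocks: two-level trees of 2-out-of-[K] gates *)

Section Blocks.
Variables K r : nat.

(** The inputs are split into [K] classes of size [r], and a gate at the lower
    level reads one input of each class; its [K] inputs are then distinct
    whatever function is chosen. *)
Definition row := {ffun 'I_K -> 'I_r}.
Definition table := {ffun 'I_K -> row}.

Implicit Types S : {set 'I_K * 'I_r}.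

Definition row_on S (w : row) := 1 < #|[set k | (k, w k) \in S]|.
Definition table_on S (t : table) := 1 < #|[set i | row_on S (t i)]|.

Lemma row_onS S S' w : S \subset S' -> row_on S w -> row_on S' w.
Proof.
move=> /subsetP SS' /leq_trans; apply; apply/subset_leq_card/subsetP=> k.
by rewrite !inE => /SS'.
Qed.

Lemma table_onS S S' t : S \subset S' -> table_on S t -> table_on S' t.
Proof.
move=> SS' /leq_trans; apply; apply/subset_leq_card/subsetP=> i.
by rewrite !inE; exact: row_onS.
Qed.

Lemma card_row_on S :
  #|[set w | row_on S w]| * r ^ 2 <= #|S| ^ 2 * #|{: row}|.
Proof.
have := card_ffun_two_hits (fun k => [set y | (k, y) \in S]).
rewrite -card_ffun card_ord (_ : \sum_k _ = #|S|); last first.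
  under eq_bigr do rewrite -sum1_card.
  rewrite pair_big_dep /= sum1_card; apply: eq_card => -[k y].
  by have := in_set (fun y0 => (k, y0) \in S) y.
congr (_ * _ <= _); apply: eq_card => w; rewrite !inE /row_on.
by congr (_ < _); apply: eq_card => k; rewrite !inE.
Qed.

Lemma card_table_on S : 0 < r ->
  #|[set t | table_on S t]| * r ^ 4 <= K ^ 2 * #|S| ^ 4 * #|{: table}|.
Proof.
move=> r_gt0.
have := card_ffun_two_hits (fun _ : 'I_K => [set w | row_on S w]).
rewrite sum_nat_const -card_ffun card_ord.
have -> : [set t : table |
    1 < #|[set i | t i \in (fun=> [set w | row_on S w]) i]|]
          = [set t | table_on S t].
  apply/setP=> t; rewrite !inE /table_on.
  by congr (_ < _); apply: eq_card => i; rewrite !inE.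
set a := #|[set w | row_on S w]|; set b := #|[set t | table_on S t]|.
set rho := #|{: row}|.
set tau := #|{ffun _}|; rewrite -/tau => le_b.
have rho_gt0 : 0 < rho by rewrite /rho /row card_ffun !card_ord expn_gt0 r_gt0.
rewrite -(@leq_pmul2r (rho ^ 2)) ?expn_gt0 ?rho_gt0 //.
apply: (@leq_trans ((K * a) ^ 2 * tau * r ^ 4)).
  by rewrite mulnAC leq_mul2r le_b orbT.
have -> : (K * a) ^ 2 * tau * r ^ 4 = K ^ 2 * (a * r ^ 2) ^ 2 * tau.
  by ring.
have -> : K ^ 2 * #|S| ^ 4 * tau * rho ^ 2
        = K ^ 2 * (#|S| ^ 2 * rho) ^ 2 * tau.
  by ring.
by rewrite leq_mul2r leq_mul2l leq_exp2r // card_row_on !orbT.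
Qed.

(** By the first moment method.  A failure is a pair of a set [S] of [s] inputs
    and a set [J] of [s] blocks, all switched on by [S].  With [n = K r] and
    [tau] the number of tables, the union bound reads
    [tau ^ n <= 'C(n, s) ^ 2 * (K ^ 2 * s ^ 4 / r ^ 4) ^ s * tau ^ n] if every
    choice fails; inserting ['C(n, s) <= (4 n / s) ^ s] leaves
    [r ^ 2 <= (4 K ^ 2 s) ^ 2]. *)
Lemma dispersing_tables s : 0 < s -> 4 * K ^ 2 * s < r ->
  exists f : {ffun 'I_K * 'I_r -> table},
    forall S, #|S| <= s -> #|[set j | table_on S (f j)]| < s.
Proof.
move=> s_gt0 lt_s_r; have r_gt0 : 0 < r by apply: leq_ltn_trans lt_s_r.
pose D := [set S : {set 'I_K * 'I_r} | #|S| == s].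
pose E (p : {set 'I_K * 'I_r} * {set 'I_K * 'I_r}) :=
  [set f : {ffun 'I_K * 'I_r -> table} |
    [forall j in p.2, f j \in [set t | table_on p.1 t]]].
pose Bad := [set f | [exists p, (p \in setX D D) && (f \in E p)]].
have [Bad_all|] := boolP ([set: {ffun 'I_K * 'I_r -> table}] \subset Bad).
  exfalso; set tau := #|{: table}|; set n := K * r.
  have cardI : #|{: 'I_K * 'I_r}| = n by rewrite card_prod !card_ord.
  have tau_gt0 : 0 < tau.
    by rewrite /tau /table /row !card_ffun !card_ord !expn_gt0 r_gt0.
  have le_E p : p \in setX D D ->
      #|E p| * (r ^ 4) ^ s <= (K ^ 2 * s ^ 4) ^ s * tau ^ n.
    rewrite inE => /andP[]; rewrite !inE => /eqP S_s /eqP J_s.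
    have := card_ffun_constrained p.2 (fun=> [set t | table_on p.1 t]).
    rewrite prod_nat_const J_s cardI -/tau => E_eq.
    rewrite -(@leq_pmul2r (tau ^ s)) ?expn_gt0 ?tau_gt0 //.
    rewrite mulnAC E_eq mulnAC -expnMn mulnAC -expnMn leq_mul2r.
    by rewrite leq_exp2r // -S_s card_table_on ?orbT.
  have : tau ^ n <= \sum_(p in setX D D) #|E p|.
    apply: leq_trans (leq_card_exists _ _).
    by rewrite -cardI -card_ffun -cardsT subset_leq_card.
  rewrite -(@leq_pmul2r ((r ^ 4) ^ s)) ?expn_gt0 ?r_gt0 //.
  have le_sum := @leq_sum _ (index_enum _) _ _ _ le_E.
  rewrite big_distrl /= => /leq_trans/(_ le_sum).
  rewrite sum_nat_const cardsX card_draws cardI mulnA [leqLHS]mulnC.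
  rewrite leq_pmul2r ?expn_gt0 ?tau_gt0 //.
  rewrite -(@leq_pmul2r (s ^ s * s ^ s)) ?muln_gt0 ?expn_gt0 ?s_gt0 //.
  rewrite mulnAC mulnACA => /leq_trans le_prod.
  have /le_prod := leq_mul (leq_mul (bin_expn_leq n s)
    (bin_expn_leq n s)) (leqnn ((K ^ 2 * s ^ 4) ^ s)).
  rewrite -!expnMn leq_exp2r // /n => le_pow.
  suff : (r * r) * (r * s) ^ 2 <= (4 * K ^ 2 * s) ^ 2 * (r * s) ^ 2.
    rewrite leq_pmul2r ?expn_gt0 ?muln_gt0 ?r_gt0 ?s_gt0 //.
    by rewrite leqNgt mulnn ltn_exp2r // lt_s_r.
  by move: le_pow; congr (_ <= _); ring.
case/subsetPn=> f _; rewrite inE => /existsPn f_good; exists f => S S_s.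
rewrite ltnNge; apply/negP=> s_J.
have [J subJ J_s] := subset_of_card s_J.
have [|S' subS S'_s] := @superset_of_card _ S s.
  by rewrite S_s /= -J_s max_card.
have /negP := f_good (S', J); apply.
rewrite !inE /= S'_s J_s eqxx /=; apply/forall_inP=> j Jj.
rewrite inE; apply: table_onS subS _.
by have := subsetP subJ _ Jj; rewrite inE.
Qed.

End Blocks.
(** * Circuits and their thresholds *)

Record circuit (K : nat) (I : finType) := Circuit {
  gate : finType;
  root : gate;
  wire : gate -> 'I_K -> gate + I;
  wire_inj : forall g, injective (wire g) }.

Arguments root {K I} c.
Arguments wire {K I} c _ _.

Section CircuitTheory.
Variables (K : nat) (I : finType).
Implicit Types (c : circuit K I) (a : nat).

Definition supported a c (X : pred (gate c + I)) :=
  forall g, X (inl g) -> a <= #|[set i | X (wire c g i)]|.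

(** A form of acyclicity: along successors, every gate leads to an input. It is
    stated on supported sets so that it passes to compositions without a rank
    function. *)
Definition grounded c :=
  forall (X : pred (gate c + I)) g, supported 1 X -> X (inl g) ->
    exists x, X (inr x).

(** For [a = 2] and an acyclic circuit of 2-out-of-[K] gates, the largest
    supported [X] with given inputs consists of the gates that these inputs
    switch on; so fewer than [s] inputs leave the root switched off. *)
Definition needs a c s :=
  forall X : pred (gate c + I), supported a X -> X (inl (root c)) ->
    s <= #|[set x | X (inr x)]|.

Lemma supportedW a b c (X : pred (gate c + I)) :
  a <= b -> supported b X -> supported a X.
Proof. by move=> ab supX g /supX; apply: leq_trans. Qed.

Lemma grounded_wire c g i : grounded c -> wire c g i != inl g.
Proof.
move=> gc; apply/negP=> /eqP loop.
have [|x] := gc (pred1 (inl g)) g _ (eqxx _); last by [].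
move=> h /eqP[->]; apply/card_gt0P; exists i; rewrite inE.
by rewrite loop /= eqxx.
Qed.

Lemma grounded_needs1 a c : 0 < a -> grounded c -> needs a c 1.
Proof.
move=> a_gt0 gc X /(supportedW a_gt0) supX Xr.
have [x Xx] := gc X _ supX Xr.
by apply/card_gt0P; exists x; rewrite inE.
Qed.

Lemma needsW a c s s' : s' <= s -> needs a c s -> needs a c s'.
Proof. by move=> le_s's nc X supX Xr; apply: leq_trans (nc X supX Xr). Qed.

End CircuitTheory.

(** Each input [j] of [c] becomes the root of the block with table [f j]. *)
Section Compose.
Variables (K r : nat).
Local Notation I := ('I_K * 'I_r)%type.
Variables (c : circuit K I) (f : I -> table K r).

(** [inr (j, None)] is the root of block [j] and [inr (j, Some i)] its row [i]. *)
Definition compose_gate : finType := (gate c + I * option 'I_K)%type.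

Definition plug (x : gate c + I) : compose_gate + I :=
  match x with inl g => inl (inl g) | inr j => inl (inr (j, None)) end.

Definition compose_wire (g : compose_gate) (k : 'I_K) : compose_gate + I :=
  match g with
  | inl g => plug (wire c g k)
  | inr (j, None) => inl (inr (j, Some k))
  | inr (j, Some i) => inr (k, f j i k)
  end.

Lemma compose_wire_inj g : injective (compose_wire g).
Proof.
case: g => [g|[j [i|]]] k k' /=; [|by case|by case].
move=> eq_plug; apply: (@wire_inj _ _ c g).
by move: eq_plug; case: (wire c g k) (wire c g k') => [h|x] [h'|x'] //= [->].
Qed.

Definition compose : circuit K I := Circuit (inl (root c)) compose_wire_inj.

Lemma supported_compose a (X : pred (gate compose + I)) :
  supported a X -> supported (c := c) a (X \o plug).
Proof. by move=> supX g Xg; apply: supX (inl g) Xg. Qed.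

Lemma grounded_compose : 0 < K -> grounded c -> grounded compose.
Proof.
move=> K_gt0 gc X g supX.
have X_row j i : X (inl (inr (j, Some i))) -> exists x, X (inr x).
  by move=> /supX /card_gt0P[k]; rewrite inE /=; exists (k, f j i k).
have X_block j : X (inl (inr (j, None))) -> exists x, X (inr x).
  by move=> /supX /card_gt0P[k]; rewrite inE; exact: X_row.
case: g => [g Xg|[j [i|]]]; [|exact: X_row|exact: X_block].
by have [j] := gc _ g (supported_compose supX) Xg; exact: X_block.
Qed.

(** If [X] selects at most [s] inputs, then fewer than [s] blocks are switched
    on by them, and the selected block roots are among these. *)
Lemma needs_compose s :
  (forall S : {set I}, #|S| <= s -> #|[set j | table_on S (f j)]| < s) ->
  needs 2 c s -> needs 2 compose s.+1.
Proof.
move=> disp nc X supX Xr; rewrite ltnNge; apply/negP=> few.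
have := nc _ (supported_compose supX) Xr; apply/negP; rewrite -ltnNge.
apply: leq_ltn_trans (disp _ few); apply/subset_leq_card/subsetP=> j.
rewrite !inE => /supX /leq_trans; apply.
apply/subset_leq_card/subsetP=> i; rewrite !inE /= => /supX /leq_trans; apply.
by apply/subset_leq_card/subsetP=> k; rewrite !inE.
Qed.

End Compose.

(** The number of inputs does not grow along the induction on [s]; only the depth
    does.  A single gate starts it. *)
Lemma threshold_circuit K r m s : 0 < K -> 4 * K ^ 2 * m <= r -> 0 < s <= m ->
  exists2 c : circuit K ('I_K * 'I_r)%type, grounded c & needs 2 c s.
Proof.
move=> K_gt0 le_m_r; case: s => // s; elim: s => [|s IH] le_s_m.
  have r_gt0 : 0 < r.
    by apply: leq_trans le_m_r; rewrite !muln_gt0 K_gt0.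
  pose w (g : unit) (k : 'I_K) : unit + 'I_K * 'I_r := inr (k, Ordinal r_gt0).
  have w_inj g : injective (w g) by move=> k k' [].
  have gc : grounded (Circuit tt w_inj).
    move=> X [] supX /supX /card_gt0P[k]; rewrite inE.
    by exists (k, Ordinal r_gt0).
  by exists (Circuit tt w_inj) => //; exact: grounded_needs1.
have [|c gc nc] := IH; first exact: ltnW.
have [||f disp] := @dispersing_tables K r s.+1 => //.
  by apply: leq_trans le_m_r; rewrite ltn_pmul2l // muln_gt0 expn_gt0 K_gt0.
exists (compose c f); first exact: grounded_compose.
exact: needs_compose.
Qed.

(** * Out-degrees in induced subdigraphs *)
(* [path.arc] would hide the arcs of a digraph. *)
Local Notation arc := Defs.arc.

Definition inner_outdeg (D : digraph) (X : {set D}) (v : D) :=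
  #|[set w in X | arc v w]|.

Lemma leq_min_outdeg (D : digraph) s :
  (s <= min_outdeg D) <-> (forall v : D, s <= outdeg v).
Proof.
split=> [sD v|sD].
  apply: leq_trans sD _; rewrite /min_outdeg.
  have : v \in index_enum D by rewrite mem_index_enum.
  elim: index_enum => // w u IH; rewrite in_cons big_cons geq_min.
  by case/orP=> [/eqP->|/IH->]; rewrite ?leqnn ?orbT.
rewrite /min_outdeg; elim/big_ind: _ => [|x y sx sy|v _]; last exact: sD.
  have /card_gt0P[v _] := vertex_gt0 D.
  by rewrite (leq_trans (sD v)) ?max_card.
by rewrite leq_min sx.
Qed.

Lemma outdeg_induced (D : digraph) (X : {set D}) (X0 : X != set0)
    (x : induced X0) : outdeg x = inner_outdeg X (val x).
Proof.
rewrite /outdeg -(card_imset _ val_inj); apply: eq_card => w; rewrite !inE.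
apply/imsetP/andP=> [[y + ->]|[wX vw]].
  by rewrite inE => ?; rewrite (valP y).
by exists (Sub w wX); rewrite ?inE.
Qed.

Lemma min_outdeg_induced (D : digraph) (X : {set D}) (X0 : X != set0) s :
  (s <= min_outdeg (induced X0)) <->
  (forall v, v \in X -> s <= inner_outdeg X v).
Proof.
rewrite leq_min_outdeg; split=> sX v; last by rewrite outdeg_induced sX ?(valP v).
by move=> Xv; have := sX (Sub v Xv); rewrite outdeg_induced.
Qed.

(** * Substituting a circuit for every vertex *)

Section Substitution.
Variables (D : digraph) (K : nat) (I : finType) (c : circuit K I).
Variables (gc : grounded c) (out : D -> I -> D).
Hypotheses (out_inj : forall v, injective (out v))
           (out_arc : forall v x, arc v (out v x)).

(** The root of the copy at [v] stands for [v] itself, so an input [x] of that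
    copy is the root of the copy at [out v x]. *)
Definition target (v : D) (y : gate c + I) : D * gate c :=
  match y with inl g => (v, g) | inr x => (out v x, root c) end.

Definition subst_arc : rel (D * gate c) :=
  fun p q => [exists i, target p.1 (wire c p.2 i) == q].

Lemma target_inj v : injective (target v).
Proof.
have no_loop x : out v x <> v.
  by move=> eq_v; have := out_arc v x; rewrite eq_v arc_irr.
case=> [g|x] [h|y] /= []; first by move=> ->.
- by move/esym/no_loop.
- by move/no_loop.
- by move/out_inj->.
Qed.

Lemma subst_arc_irr : irreflexive subst_arc.
Proof.
case=> v g; rewrite /subst_arc; apply/negbTE/negP=> /existsP[i] /eqP /= loop.
by have /eqP := grounded_wire g i gc; apply; apply: (@target_inj v).
Qed.

Lemma subst_gt0 : 0 < #|{: D * gate c}|.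
Proof.
have /card_gt0P[v _] := vertex_gt0 D.
by apply/card_gt0P; exists (v, root c).
Qed.

Definition subst_digraph := Digraph subst_arc_irr subst_gt0.

Lemma subst_outdeg (p : subst_digraph) : outdeg p = K.
Proof.
pose t i : subst_digraph := target p.1 (wire c p.2 i).
have t_inj : injective t by move=> i j /target_inj /wire_inj.
rewrite /outdeg -[RHS](card_ord K) -cardsT -(card_imset _ t_inj).
apply: eq_card => q; rewrite inE /= /subst_arc.
apply/existsP/imsetP => [[i /eqP<-]|[i _ ->]].
  by exists i.
by exists i; exact: eqxx.
Qed.

Section Part.
Variables (a s : nat) (Y : {set subst_digraph}).
Hypotheses (a_gt0 : 0 < a) (Y0 : Y != set0).
Hypothesis aY : forall p, p \in Y -> a <= inner_outdeg Y p.
Hypothesis needs_c : needs a c s.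

Definition trace : {set D} := [set v | (v, root c) \in Y].

(** Read in the copy at [v], with its inputs replaced by the out-neighbours that
    they stand for, a part of minimum out-degree [a] is an [a]-supported set. *)
Lemma supported_target v : supported a (fun y => target v y \in Y).
Proof.
move=> g /aY /leq_trans; apply.
rewrite -(card_imset _ (inj_comp (@target_inj v) (@wire_inj _ _ c g))).
apply/subset_leq_card/subsetP=> q; rewrite inE /= /subst_arc.
case/andP=> qY /existsP[i /eqP eq_q].
by apply/imsetP; exists i; rewrite ?inE /= ?eq_q.
Qed.

(** A part cannot lie inside the interiors of the copies: following successors
    within one copy leads to an input, the root of another copy. *)
Lemma trace_neq0 : trace != set0.
Proof.
have /set0Pn[[v g] Yvg] := Y0.
have [x Yx] := gc (supportedW a_gt0 (@supported_target v)) Yvg.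
by apply/set0Pn; exists (out v x); rewrite inE.
Qed.

Lemma trace_outdeg v : v \in trace -> s <= inner_outdeg trace v.
Proof.
rewrite inE => Yv.
apply: leq_trans (needs_c (@supported_target v) Yv) _.
rewrite -(card_imset _ (@out_inj v)); apply/subset_leq_card/subsetP=> w.
by case/imsetP=> x; rewrite inE => Yx ->; rewrite !inE Yx out_arc.
Qed.

End Part.
End Substitution.

Lemma out_embedding (D : digraph) (I : finType) : #|I| <= min_outdeg D ->
  exists out : D -> I -> D,
    (forall v, injective (out v)) /\ (forall v x, arc v (out v x)).
Proof.
move/leq_min_outdeg => degD.
pose out v x : D := enum_val (widen_ord (degD v) (enum_rank x)).
exists out; split=> v x; last first.
  by have := enum_valP (widen_ord (degD v) (enum_rank x)); rewrite inE.
by move=> y /enum_val_inj /(congr1 val) /= /ord_inj/enum_rank_inj.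
Qed.

(** The two parts are allowed different requirements [a] and [b], as the part
    of target 1 only needs to be 1-out. *)
Lemma forces_split_scale s t a b K m : 0 < m -> 0 < K -> 0 < a -> 0 < b ->
  (forall (I : finType) (c : circuit K I), grounded c -> needs 2 c m ->
     needs a c s /\ needs b c t) ->
  forces_split a b K -> forces_split s t (4 * K ^ 3 * m).
Proof.
move=> m_gt0 K_gt0 a_gt0 b_gt0 lift splitK D degD.
have [|c gc nc] := @threshold_circuit K (4 * K ^ 2 * m) m m K_gt0 (leqnn _).
  by rewrite m_gt0 leqnn.
have [|out [out_inj out_arc]] :=
  @out_embedding D ('I_K * 'I_(4 * K ^ 2 * m))%type.
  by rewrite card_prod !card_ord; apply: leq_trans degD; rewrite eq_leq //; ring.
pose D' := subst_digraph gc out_inj out_arc.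
have [|A [B [A0 [B0 [AB_T AB_dis aA bB]]]]] := splitK D'.
  by apply/leq_min_outdeg=> p; rewrite subst_outdeg.
move/min_outdeg_induced in aA; move/min_outdeg_induced in bB.
exists (trace A), (trace B), (trace_neq0 a_gt0 A0 aA), (trace_neq0 b_gt0 B0 bB).
split.
- by apply/setP=> v; have /setP/(_ (v, root c)) := AB_T; rewrite !inE.
- rewrite -setI_eq0; apply/eqP/setP=> v; rewrite !inE.
  by move: AB_dis; rewrite -setI_eq0 => /eqP/setP/(_ (v, root c)); rewrite !inE.
- by apply/min_outdeg_induced; apply: trace_outdeg aA _; case: (lift _ c).
- by apply/min_outdeg_induced; apply: trace_outdeg bB _; case: (lift _ c).
Qed.

(** * The lower bound from complete digraphs *)

Lemma neq_irr n : irreflexive (fun x y : 'I_n => x != y).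
Proof. by move=> x; rewrite eqxx. Qed.

Lemma ord_gt0 n : 0 < #|'I_n.+1|.
Proof. by rewrite card_ord. Qed.

Definition complete_digraph n := Digraph (@neq_irr n.+1) (ord_gt0 n).

Lemma complete_inner_outdeg n (X : {set complete_digraph n}) v :
  v \in X -> (inner_outdeg X v).+1 = #|X|.
Proof.
move=> Xv; rewrite (cardsD1 v) Xv; congr _.+1; apply: eq_card => w.
by rewrite !inE andbC eq_sym.
Qed.

Lemma forces_split_gt s t k : forces_split s t k -> s + t < k.
Proof.
move=> split_k.
have [|A [B [A0 [B0 [AB_T AB_dis sA tB]]]]] := split_k (complete_digraph k).
  apply/leq_min_outdeg=> v; rewrite -ltnS -[k.+1]card_ord -cardsT.
  rewrite -(complete_inner_outdeg (in_setT v)) ltnS.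
  by apply/subset_leq_card/subsetP=> w; rewrite !inE.
have card_part s' (X : {set complete_digraph k}) (X0 : X != set0) :
    s' <= min_outdeg (induced X0) -> s' < #|X|.
  move/min_outdeg_induced=> sX; have /set0Pn[v Xv] := X0.
  by rewrite -(complete_inner_outdeg Xv) ltnS sX.
have : #|A :|: B| = k.+1 by rewrite AB_T cardsT card_ord.
have /eqP-> : #|A :|: B| == #|A| + #|B| by rewrite leq_card_setU AB_dis.
move=> AB_k.
by have := leq_add (card_part _ _ _ sA) (card_part _ _ _ tB); lia.
Qed.

(** * Bounds on [F] *)

Local Open Scope ring_scope.
Local Open Scope ereal_scope.

Section Thresholds.
Variable R : realType.

Lemma F_finP s t : F R s t < +oo ->
  exists2 k : nat, F R s t = k%:R%:E & forces_split s t k.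
Proof.
rewrite /F /split_threshold; case: boolp.pselect => [ex_k|_];
  last by rewrite ltxx.
by case: ex_minnP => k /boolp.asboolP split_k _ _; exists k.
Qed.

Lemma F_le s t k : forces_split s t k -> F R s t <= k%:R%:E.
Proof.
move=> split_k; rewrite /F /split_threshold.
case: boolp.pselect => [ex_k|[]]; last by exists k.
by case: ex_minnP => j _ /(_ k) le_jk;
  rewrite lee_fin ler_nat le_jk //; apply/boolp.asboolP.
Qed.

Lemma F_ge s t : (s + t)%N%:R%:E <= F R s t.
Proof.
have [fin|] := boolP (F R s t < +oo).
  have [k -> /forces_split_gt lt_k] := F_finP fin.
  by rewrite lee_fin ler_nat ltnW.
by rewrite -leNgt; apply: le_trans; rewrite leey.
Qed.

Lemma F_lt_scaled s t K m : (2 <= K)%N -> (0 < m)%N ->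
  forces_split s t (4 * K ^ 3 * m) ->
  F R s t < (expR 1 ^+ 2 / 3)%:E * K%:R%:E ^+ 6 * m%:R%:E.
Proof.
move=> K2 m_gt0 /F_le /le_lt_trans; apply.
rewrite -EFin_expe -!EFinM lte_fin natrM ltr_pM2r ?ltr0n //.
have e2 : (2 <= expR 1 :> R)%R by have := expR_ge1Dx (1 : R); lra.
have e4 : (4 <= expR 1 ^+ 2 :> R)%R by nra.
have K8 : (8 <= K%:R ^+ 3 :> R)%R by rewrite -natrX ler_nat (@leq_exp2r 2 K 3).
rewrite natrM natrX -[6%N]/(3 + 3)%N exprD.
rewrite mulrA ltr_pM2r; last by lra.
by nra.
Qed.

End Thresholds.

Theorem theorem1 (R : realType) :
  (F R 2 2 < +oo ->
     (exists c C : R, [/\ (0 < c)%R, (0 < C)%R &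
        forall s t : nat, (1 <= s)%N -> (1 <= t)%N ->
          (c * (s + t)%N%:R)%:E <= F R s t /\
          F R s t <= (C * (s + t)%N%:R)%:E]) /\
     (forall s t : nat, (1 <= s)%N -> (1 <= t)%N ->
        F R s t <
          (expR 1 ^+ 2 / 3)%:E * F R 2 2 ^+ 6 * (maxn s t)%:R%:E))
  /\
  (F R 2 1 < +oo ->
     (exists c C : R, [/\ (0 < c)%R, (0 < C)%R &
        forall s : nat, (1 <= s)%N ->
          (c * s%:R)%:E <= F R s 1 /\ F R s 1 <= (C * s%:R)%:E]) /\
     (forall s : nat, (1 <= s)%N ->
        F R s 1 < (expR 1 ^+ 2 / 3)%:E * F R 2 1 ^+ 6 * s%:R%:E)).
Proof.
have C_gt0 K : (2 <= K)%N -> (0 < expR 1 ^+ 2 / 3 * K%:R ^+ 6 :> R)%R.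
  move=> /ltnW K_gt0; apply: mulr_gt0; last by rewrite exprn_gt0 ?ltr0n.
  by rewrite divr_gt0 ?ltr0n ?exprn_gt0 ?expR_gt0.
split=> /F_finP[K -> splitK].
- have K2 : (2 <= K)%N by have := forces_split_gt splitK; lia.
  have main s t : (1 <= s)%N -> (1 <= t)%N -> F R s t <
      (expR 1 ^+ 2 / 3)%:E * K%:R%:E ^+ 6 * (maxn s t)%:R%:E.
    move=> s1 t1; have m_gt0 : (0 < maxn s t)%N by rewrite leq_max s1.
    apply: F_lt_scaled => //.
    apply: forces_split_scale splitK => //; first exact: ltn_trans K2.
    by move=> I c _ nc; split; apply: needsW nc; rewrite (leq_maxl, leq_maxr).
  split=> //; exists 1%R, (expR 1 ^+ 2 / 3 * K%:R ^+ 6)%R.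
  split=> // [|s t s1 t1]; first exact: C_gt0.
  rewrite mul1r; split; first exact: F_ge.
  apply: (le_trans (ltW (main s t s1 t1))).
  rewrite -EFin_expe -!EFinM lee_fin ler_pM2l ?C_gt0 // ler_nat.
  by rewrite geq_max leq_addr leq_addl.
- have K2 : (2 <= K)%N by have := forces_split_gt splitK; lia.
  have main s : (1 <= s)%N ->
      F R s 1 < (expR 1 ^+ 2 / 3)%:E * K%:R%:E ^+ 6 * s%:R%:E.
    move=> s1; apply: F_lt_scaled => //.
    apply: forces_split_scale splitK => //; first exact: ltn_trans K2.
    by move=> I c gc nc; split=> //; exact: grounded_needs1.
  split=> //; exists 1%R, (expR 1 ^+ 2 / 3 * K%:R ^+ 6)%R.
  split=> // [|s s1]; first exact: C_gt0.
  rewrite mul1r; split.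
    by apply: le_trans (F_ge R s 1); rewrite lee_fin ler_nat leq_addr.
  apply: (le_trans (ltW (main s s1))).
  by rewrite -EFin_expe -!EFinM.
Qed.
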